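(* Let $K$ be a field of characteristic $2$, let $V$ be a vector space of finite dimension $n$ over $K$, and let $\mathcal{M}$ be a subspace of $\mathrm{Symm}(V)$ with $\mathcal{M}\cap \mathrm{Alt}(V)=0$. Suppose that all elements of $\mathcal{M}$ have rank at most $r$, where $r$ is an integer. Then, provided $|K|\geq r+1$, we have $\dim \mathcal{M}\leq r$.
   Context: $\mathrm{Symm}(V)$ denotes the $K$-vector space of symmetric bilinear forms $V\times V\to K$, and $\mathrm{Alt}(V)$ denotes its subspace of alternating bilinear forms (those $f$ with $f(v,v)=0$ for all $v\in V$; in characteristic $2$ these are symmetric). The rank of a form $f$ is $\dim V-\dim \mathrm{rad}\,f$, where $\mathrm{rad}\,f=\{u\in V: f(u,v)=0 \text{ for all } v\in V\}$. The condition $|K|\geq r+1$ holds automatically when $K$ is infinite. *)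

(* Defs.v *)
From mathcomp Require Import all_boot all_order all_algebra.

Set Implicit Arguments.
Unset Strict Implicit.
Unset Printing Implicit Defensive.

Import Order.TTheory GRing.Theory Num.Theory.
Local Open Scope ring_scope.

(* Bilinear forms V x V -> K are curried, so that they make up a
   finite-dimensional K-space; [{vspace bilform K V}] is the type of its
   subspaces. *)
Notation bilform K V := 'Hom(V, 'Hom(V, K^o)).

Section BilinearForms.
Variables (K : fieldType) (V : vectType K).
Implicit Type f : bilform K V.

Definition form_symmetric f : Prop := forall u v : V, f u v = f v u.

Definition form_alternating f : Prop := forall v : V, f v v = 0.

Definition form_rad f : {vspace V} := lker f.

Lemma form_radP f u : reflect (forall v : V, f u v = 0) (u \in form_rad f).
Proof.
rewrite memv_ker; apply: (iffP eqP) => [-> v | fu0]; first by rewrite lfunE.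
by apply/lfunP => v; rewrite fu0 lfunE.
Qed.

Definition form_rank f : nat := (\dim {:V} - \dim (form_rad f))%N.

End BilinearForms.

(* The cardinality bound |T| >= m, where T may be infinite. *)
Definition card_ge (T : eqType) (m : int) : Prop :=
  exists2 s : seq T, uniq s & m <= (size s)%:Z.

(* Main.v *)
Require Import Defs.
From HB Require Import structures.
From mathcomp Require Import all_boot all_order all_algebra.
From mathcomp Require Import perm.

Import Order.TTheory GRing.Theory Num.Theory.
Local Open Scope ring_scope.

(** In characteristic 2 the map v |-> f(v,v) of a symmetric form f is additive
    and satisfies f(cv,cv) = c^2 f(v,v); so f is alternating as soon as
    f(v,v) = 0 for v in a spanning family.

    Choose A in M of maximal rank s, with radical R and a complement W of R,
    which has dimension s.  The key point ([diag_form_rad_eq0]) is that every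
    f in M satisfies f(u,u) = 0 for all u in R.  Indeed let e be a basis of W,
    and consider the Gram determinant of tA + f on the s + 1 vectors
    e_1, ..., e_s, u.  It is a polynomial in t of degree at most s, because
    A(u,-) = 0, and its coefficient at t^s is det(A|W) f(u,u).  It vanishes for
    every t in K, because tA + f has rank at most s; as K has more than s
    elements it is the zero polynomial, and det(A|W) <> 0.

    Hence a form f in M is alternating, that is zero, once f(e_i,e_i) = 0 for
    all i: the linear map f |-> (f(e_i,e_i))_i from M to K^s is injective, and
    dim M <= s <= r. *)

(** * Top coefficients of products and determinants of polynomials *)

Section TopCoefficient.
Set Implicit Arguments.
Unset Strict Implicit.

Lemma coefM_top (R : nzRingType) (p q : {poly R}) (a b : nat) :
  (size p <= a.+1)%N -> (size q <= b.+1)%N -> (p * q)`_(a + b) = p`_a * q`_b.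
Proof.
move=> szp szq; rewrite coefM.
have lt_a : (a < (a + b).+1)%N by rewrite ltnS leq_addr.
rewrite (bigD1 (Ordinal lt_a)) //= addKn big1 ?addr0 // => i.
rewrite -val_eqE /= => ne_ia; case: (ltngtP i a) ne_ia => // [lt_ia|lt_ai] _.
  rewrite [q`__]nth_default ?mulr0 //; apply: leq_trans szq _.
  by rewrite ltn_subRL ltn_add2r.
by rewrite nth_default ?mul0r //; apply: leq_trans szp _.
Qed.

Lemma coef_prod_top (R : comNzRingType) (I : Type) (s : seq I)
    (p : I -> {poly R}) (d : I -> nat) :
  (forall i, (size (p i) <= (d i).+1)%N) ->
  (size (\prod_(i <- s) p i)%R <= (\sum_(i <- s) d i).+1)%N
  /\ (\prod_(i <- s) p i)`_(\sum_(i <- s) d i)%N = \prod_(i <- s) (p i)`_(d i).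
Proof.
move=> szp; elim: s => [|i s [IHsz IHco]].
  by rewrite !big_nil size_poly1 coef1.
rewrite !big_cons; split; last by rewrite coefM_top // IHco.
apply: leq_trans (size_polyMleq _ _) _.
by rewrite -subn1 leq_subLR add1n -addnS -addSn leq_add.
Qed.

(** Each term of the Leibniz expansion takes one entry from every row, so the
    row degrees add up, and the top coefficient is taken entry by entry. *)
Lemma coef_det_top (R : comNzRingType) (n : nat) (N : 'M[{poly R}]_n)
    (d : 'I_n -> nat) :
  (forall i j, (size (N i j) <= (d i).+1)%N) ->
  (size (\det N) <= (\sum_i d i).+1)%N
  /\ (\det N)`_(\sum_i d i)%N = \det (\matrix_(i, j) (N i j)`_(d i)).
Proof.
move=> szN.
have top (s : 'S_n) := @coef_prod_top R _ (index_enum 'I_n)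
  (fun i => N i (s i)) d (fun i => szN i (s i)).
split.
  apply: leq_trans (size_sum _ _ _) _; apply/bigmax_leqP => s _.
  by rewrite -signr_odd; case: odd;
    rewrite ?expr1 ?mulN1r ?size_polyN ?mul1r; have [] := top s.
rewrite coef_sum; apply: eq_bigr => s _.
rewrite -(rmorph_sign (@polyC R)) coefCM; have [_ ->] := top s.
by congr (_ * _); apply: eq_bigr => i _; rewrite mxE.
Qed.

End TopCoefficient.

(** * Gram matrices and the complement of a radical *)

Section GramMatrices.
Set Implicit Arguments.
Unset Strict Implicit.
Variables (K : fieldType) (V : vectType K).
Implicit Types (f A : bilform K V).

Lemma form_suml f (I : finType) (c : I -> K) (x : I -> V) v :
  f (\sum_i c i *: x i) v = \sum_i c i * f (x i) v.
Proof.
by rewrite linear_sum sum_lfunE; apply: eq_bigr => i _; rewrite linearZ lfunE.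
Qed.

Definition gram f n (x : 'I_n -> V) : 'M[K]_n := \matrix_(i, j) f (x i) (x j).

(** The functionals f(x_i, -) lie in the image of f, whose dimension is the
    rank of f; so the Gram matrix factors through a space of that dimension. *)
Lemma det_gram_eq0 f n (x : 'I_n -> V) :
  (form_rank f < n)%N -> \det (gram f x) = 0.
Proof.
have -> : form_rank f = \dim (limg f).
  by rewrite /form_rank -(limg_ker_dim f fullv) capfv addKn.
move=> lt_rn; pose B := vbasis (limg f).
have fE i : f (x i) = \sum_k coord B k (f (x i)) *: B`_k.
  by apply: coord_vbasis; rewrite memv_img ?memvf.
have gramE : gram f x = (\matrix_(i, k) coord B k (f (x i)))
                          *m (\matrix_(k, j) (B`_k : 'Hom(V, K^o)) (x j)).
  apply/matrixP => i j; rewrite !mxE {1}fE sum_lfunE.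
  by apply: eq_bigr => k _; rewrite lfunE !mxE.
apply/eqP/negPn; rewrite -unitfE -unitmxE -row_free_unit gramE.
apply: contraL lt_rn => /eqP <-; rewrite -leqNgt.
by apply: leq_trans (mulmx_max_rank _ _) _.
Qed.

Definition compl_basis A (i : 'I_(\dim (form_rad A)^C)) : V :=
  (vbasis (form_rad A)^C)`_i.
Arguments compl_basis : clear implicits.

Lemma rad_complP A v :
  exists2 u, u \in form_rad A & exists c, v = u + \sum_i c i *: compl_basis A i.
Proof.
have : v \in (form_rad A + (form_rad A)^C)%VS by rewrite addv_complf memvf.
move=> /memv_addP[u uR [w wC ->]]; exists u => //.
by exists (fun i => coord (vbasis (form_rad A)^C) i w);
  rewrite [w in LHS](coord_vbasis wC).
Qed.

(** A vector of the complement that is orthogonal to the complement is, by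
    symmetry, orthogonal to the radical too; so it lies in both and is 0. *)
Lemma det_gram_compl A : form_symmetric A -> \det (gram A (compl_basis A)) != 0.
Proof.
move=> symA; apply/det0P => -[c c_neq0 cA0].
pose w := \sum_i c 0 i *: compl_basis A i.
have wA v : A w v = 0.
  have [u /form_radP uR [b ->]] := rad_complP A v.
  rewrite linearD /= (symA w u) uR add0r symA form_suml big1 // => j _.
  have /matrixP/(_ 0 j) := cA0; rewrite !mxE => wj.
  apply/eqP; rewrite mulf_eq0; apply/orP; right; apply/eqP.
  by rewrite symA form_suml -[RHS]wj; apply: eq_bigr => i _; rewrite mxE.
have w0 : w = 0.
  apply/eqP; rewrite -memv0 -(capv_compl (form_rad A)) memv_cap.
  apply/andP; split; first exact/form_radP.
  by apply: rpred_sum => i _; rewrite rpredZ ?vbasis_mem ?mem_nth ?size_tuple.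
have /freeP free_e := basis_free (vbasisP (form_rad A)^C).
by case/eqP: c_neq0; apply/rowP => i; rewrite mxE (free_e (c 0)).
Qed.

End GramMatrices.
Arguments compl_basis {K V} A i.

(** * Spaces of symmetric forms of bounded rank *)

Section BoundedRank.
Set Implicit Arguments.
Unset Strict Implicit.
Variables (K : fieldType) (V : vectType K).
Implicit Types (f A : bilform K V) (M : {vspace bilform K V}).

(** In the Gram determinant of tA + f on a basis of a complement of rad A
    followed by u, the coefficient at t^s, with s = rank A, is the determinant
    of a block triangular matrix, with blocks the Gram matrix of A on the
    complement and f(u,u).  The s + 1 elements of K are too many roots for a
    nonzero polynomial of degree at most s. *)
Lemma diag_form_rad_eq0 A f u :
  form_symmetric A ->
  (forall t, (form_rank (t *: A + f)%R <= form_rank A)%N) ->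
  card_ge K ((form_rank A)%:Z + 1) ->
  u \in form_rad A -> f u u = 0.
Proof.
move=> symA rank_le [S uniqS cardS] uR; have /form_radP Au0 := uR.
have rankE : form_rank A = \dim (form_rad A)^C by rewrite dimv_compl.
rewrite rankE in rank_le cardS; move: rank_le cardS.
set s := \dim _ => rank_le cardS; pose e := compl_basis A : 'I_s -> V.
pose x (i : 'I_(s + 1)) := if split i is inl j then e j else u.
(* [d] bounds the degree in t of each row of the Gram matrix of tA + f: the
   last row is constant because u is in the radical of A. *)
pose d (i : 'I_(s + 1)) := if split i is inl _ then 1%N else 0%N.
pose N : 'M[{poly K}]_(s + 1) :=
  \matrix_(i, j) ((A (x i) (x j))%:P * 'X + (f (x i) (x j))%:P).
have szN i j : (size (N i j) <= (d i).+1)%N.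
  rewrite mxE /d /x; case: (split i) => [k|_].
    rewrite size_MXaddC; case: ifP => // _.
    by rewrite ltnS size_polyC; case: eqP.
  by rewrite Au0 mul0r add0r size_polyC; case: eqP.
have sum_d : (\sum_i d i = s)%N.
  rewrite big_split_ord /= big_ord1 /d (unsplitK (inr ord0)) addn0.
  under eq_bigr => i _ do rewrite (unsplitK (inl i)).
  by rewrite sum1_card card_ord.
have [szP coP] := coef_det_top szN; rewrite {}sum_d in szP coP.
have P0 : \det N = 0.
  apply/eqP/negP => /negP P_neq0.
  have rootS : all (root (\det N)) S.
    apply/allP => t _; rewrite /root -horner_evalE -det_map_mx.
    apply/eqP; rewrite -(@det_gram_eq0 _ _ (t *: A + f) _ x) ?addn1 ?ltnS //.
    congr (\det _); apply/matrixP => i j.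
    by rewrite !mxE /= horner_evalE !hornerE !lfunE /= !scale_lfunE mulrC.
  have := leq_trans (max_poly_roots P_neq0 rootS uniqS) szP.
  by rewrite ltnS leqNgt; move: cardS; rewrite -PoszD lez_nat addn1 => ->.
have topE : \matrix_(i, j) (N i j)`_(d i) =
    block_mx (gram A e) 0 (\row_j f u (e j)) (f u u)%:M.
  apply/matrixP => i j; rewrite !mxE.
  rewrite coefD coefMX !coefC /d /x; case: (split i) => k; rewrite !mxE.
    by case: (split j) => l /=; rewrite !mxE addr0 // symA Au0.
  by case: (split j) => l /=; rewrite !mxE add0r // !ord1 eqxx.
move: coP; rewrite P0 coef0 topE det_lblock det_scalar1 => /esym/eqP.
by rewrite mulf_eq0 (negPf (det_gram_compl symA)) => /eqP.
Qed.

Lemma diag_formD f u v : 2%N \in [pchar K] ->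
  form_symmetric f -> f (u + v) (u + v) = f u u + f v v.
Proof.
move=> charK2 symf; rewrite !linearD /= !lfunE /= (symf v u).
by rewrite -!addrA (addrA (f u v)) addrr_pchar2 // add0r.
Qed.

Lemma diag_form_sum f (I : finType) (c : I -> K) (x : I -> V) :
  2%N \in [pchar K] -> form_symmetric f ->
  (forall i, f (x i) (x i) = 0) ->
  f (\sum_i c i *: x i) (\sum_i c i *: x i) = 0.
Proof.
move=> charK2 symf fx0.
elim/big_rec: _ => [|i v _ fv0]; first by rewrite linear0.
by rewrite diag_formD // fv0 addr0 !linearZ /= scale_lfunE fx0 !scaler0.
Qed.

Section Diagonal.
Variables (n : nat) (x : 'I_n -> V).

Definition diag_row f : 'rV[K]_n := \row_i f (x i) (x i).

Lemma diag_row_is_linear : linear diag_row.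
Proof.
by move=> a f g; apply/rowP => i; rewrite !mxE !lfunE /= !scale_lfunE.
Qed.

HB.instance Definition _ :=
  GRing.isLinear.Build K (bilform K V) 'rV[K]_n _ diag_row diag_row_is_linear.

End Diagonal.

(** By [diag_form_rad_eq0], a form of M with zero diagonal on a basis of a
    complement of rad A is alternating, so the values on that basis determine
    it. *)
Lemma dim_le_max_rank M A : 2%N \in [pchar K] ->
  (forall f, f \in M -> form_symmetric f) ->
  (forall f, f \in M -> form_alternating f -> f = 0) ->
  A \in M -> (forall f, f \in M -> (form_rank f <= form_rank A)%N) ->
  card_ge K ((form_rank A)%:Z + 1) -> (\dim M <= form_rank A)%N.
Proof.
move=> charK2 M_symm M_alt MA maxA cardK.
pose phi := linfun (diag_row (compl_basis A)).
have ker_phi : (M :&: lker phi = 0)%VS.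
  apply/eqP; rewrite -subv0; apply/subvP => f.
  rewrite memv_cap memv0 memv_ker lfunE => /andP[Mf /eqP fe0].
  have symf := M_symm f Mf.
  apply/eqP/M_alt => // v; have [u uR [c ->]] := rad_complP A v.
  have fu0 : f u u = 0.
    apply: (diag_form_rad_eq0 (M_symm A MA)) => // t.
    by apply: maxA; rewrite rpredD ?rpredZ.
  rewrite diag_formD // fu0 add0r; apply: diag_form_sum => // i.
  by have /rowP/(_ i) := fe0; rewrite !mxE.
rewrite -(limg_dim_eq ker_phi); apply: leq_trans (dimvS (subvf _)) _.
by rewrite dimvf /dim /= mul1n /form_rank dimv_compl.
Qed.

(** Induction on the bound replaces the choice of a form of maximal rank: when
    the bound is attained [dim_le_max_rank] applies, and otherwise it can be
    lowered. *)
Lemma dim_le_rank_bound M (s : nat) : 2%N \in [pchar K] ->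
  (forall f, f \in M -> form_symmetric f) ->
  (forall f, f \in M -> form_alternating f -> f = 0) ->
  (forall f, f \in M -> (form_rank f <= s)%N) ->
  card_ge K (s%:Z + 1) -> (\dim M <= s)%N.
Proof.
move=> charK2 M_symm M_alt; elim: s => [|s IHs] M_rank cardK.
  have rank0 : form_rank (0 : bilform K V) = 0%N.
    by apply/eqP; rewrite -leqn0 M_rank ?mem0v.
  by rewrite -rank0; apply: dim_le_max_rank; rewrite ?mem0v ?rank0.
apply/negPn/negP => dimM; case/negP: (dimM); apply: leqW; apply: IHs.
  move=> f Mf; have := M_rank f Mf; rewrite leq_eqVlt => /predU1P[rkf|//].
  by case/negP: dimM; rewrite -rkf; apply: dim_le_max_rank; rewrite ?rkf.
have [S uniqS cardS] := cardK; exists S => //; apply: le_trans cardS.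
by rewrite lerD2r lez_nat.
Qed.

End BoundedRank.

Theorem theorem4 (K : fieldType) (charK2 : 2%N \in [pchar K])
    (V : vectType K) (n : nat) (dimV : \dim {:V} = n)
    (M : {vspace bilform K V})
    (M_symm : forall f, f \in M -> form_symmetric f)
    (M_alt : forall f, f \in M -> form_alternating f -> f = 0)
    (r : int)
    (M_rank : forall f, f \in M -> (form_rank f)%:Z <= r)
    (cardK : card_ge K (r + 1)) :
  (\dim M)%:Z <= r.
Proof.
case: r M_rank cardK => [s|s] M_rank cardK; last first.
  (* A negative bound is excluded by the zero form. *)
  by have := M_rank 0 (mem0v M).
by rewrite lez_nat; apply: dim_le_rank_bound.
Qed.
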